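(* Let $\mathcal D\subset\mathbb R^d$ be a bounded domain, let $\boldsymbol x_1,\dots,\boldsymbol x_m\in\mathcal D$ be pairwise distinct, and let $p_1,\dots,p_l:\mathcal D\to\mathbb R$ be continuous functions, linearly independent on $\mathcal D$, with linear span $\mathcal P_l$. Assume that $1\in\mathcal P_l$ (the constant function), that $1\le l\le m$, that the $m\times l$ matrix $E=(p_j(\boldsymbol x_i))_{1\le i\le m,\,1\le j\le l}$ satisfies $\operatorname{rank}(E^t)=l$, and that the inverse weight function $w:[0,\infty)\to[0,\infty)$ is smooth. Let $\boldsymbol x\in\mathcal D$ be such that $w(\|\boldsymbol x-\boldsymbol x_i\|)>0$ for all $i=1,\dots,m$, and put $D=2\,\mathrm{diag}\big(w(\|\boldsymbol x-\boldsymbol x_1\|),\dots,w(\|\boldsymbol x-\boldsymbol x_m\|)\big)$. Let $$A_1=D^{-1}E\left(E^tD^{-1}E\right)^{-1}E^t,\qquad A_2=A_1-I .$$ Then: (1) $A_1D^{-1}$ and $-A_2D^{-1}$ are symmetric positive semi-definite matrices; (2) the following inequality holds: $$\lambda_{\max}(A_1D^{-1})\le\frac{1}{\lambda_{\min}(D)} .$$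
   Context: $\|\cdot\|$ is the Euclidean norm, $^t$ denotes transpose, $I$ is the $m\times m$ identity matrix, and $\lambda_{\max}$, $\lambda_{\min}$ denote the largest and smallest eigenvalues of a real symmetric matrix. The function $w$ comes from a weight function $W$, strictly positive on $(0,\infty)$, via $w(r)=1/W(r)$ if $r>0$, or if $r=0$ and $W(0)<\infty$; and $w(0)=0$ if $W(0)=\infty$. In particular $w(r)>0$ for $r>0$. Under the stated hypotheses $E^tD^{-1}E$ is non-singular, so $A_1$ is well defined. *)

(* Defs.v *)
From HB Require Import structures.
From mathcomp Require Import all_boot all_order all_algebra.
From mathcomp Require Import all_classical all_reals all_analysis.

Set Implicit Arguments.
Unset Strict Implicit.
Unset Printing Implicit Defensive.

Import Order.TTheory GRing.Theory Num.Theory.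
Import numFieldNormedType.Exports.

Local Open Scope classical_set_scope.
Local Open Scope ring_scope.

(* The library norm on 'rV[R]_d is the sup norm, hence this definition. *)
Definition enorm (R : realType) (d : nat) (v : 'rV[R]_d) : R :=
  Num.sqrt (\sum_(i < d) v 0 i ^+ 2).

(* Functions on a subset Dom of R^d are represented by total functions of which
   only the values on Dom matter. *)
Definition lin_indep_on (R : realType) (d l : nat) (Dom : set 'rV[R]_d)
    (p : 'I_l -> 'rV[R]_d -> R) : Prop :=
  forall c : 'I_l -> R,
    (forall y, Dom y -> \sum_(j < l) c j * p j y = 0) -> forall j, c j = 0.

Definition in_span_on (R : realType) (d l : nat) (Dom : set 'rV[R]_d)
    (p : 'I_l -> 'rV[R]_d -> R) (f : 'rV[R]_d -> R) : Prop :=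
  exists c : 'I_l -> R, forall y, Dom y -> f y = \sum_(j < l) c j * p j y.

(* W is used on [0, +oo) only, and may be infinite at 0. *)
Definition weight_function (R : realType) (W : R -> \bar R) : Prop :=
  (forall r : R, 0 < r -> (0 < W r)%E /\ W r \is a fin_num) /\ (0 < W 0%R)%E.

Definition inverse_weight (R : realType) (W : R -> \bar R) (r : R) : R :=
  if W r == +oo%E then 0 else (fine (W r))^-1.

(* C^oo on the closed half-line [0, +oo): g n is the n-th derivative of f, which
   is one-sided at 0 since the increments h are restricted to r + h >= 0. *)
Definition smooth_on_nneg (R : realType) (f : R -> R) : Prop :=
  exists g : nat -> R -> R,
    (forall r : R, 0 <= r -> g 0%N r = f r) /\
    (forall (n : nat) (r : R), 0 <= r ->
       h^-1 * (g n (r + h) - g n r)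
         @[h --> within [set h : R | 0 <= r + h] 0^'] --> g n.+1 r).

Definition pos_semidef (R : realType) (m : nat) (A : 'M[R]_m) : Prop :=
  forall v : 'cV[R]_m, 0 <= (v^T *m A *m v) 0 0.

(* The spectrum of a symmetric real matrix of positive size is finite and
   nonempty, so that sup and inf are then the largest and smallest eigenvalue;
   these definitions are meant for such matrices only. *)
Definition lambda_max (R : realType) (m : nat) (A : 'M[R]_m) : R :=
  sup [set a : R | eigenvalue A a].

Definition lambda_min (R : realType) (m : nat) (A : 'M[R]_m) : R :=
  inf [set a : R | eigenvalue A a].

(* Main.v *)
Require Import Defs.
From HB Require Import structures.
From mathcomp Require Import all_boot all_order all_algebra.
From mathcomp Require Import all_classical all_reals all_analysis.

(* Put B = A1 D^-1 = D^-1 E (E^T D^-1 E)^-1 E^T D^-1 and C = - A2 D^-1 = D^-1 - B.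
   Since B D B = B, also C D C = C, so that both are congruences P^T D P of the
   positive definite D, hence symmetric positive semi-definite. Then B <= D^-1 in
   the Loewner order, because the difference is C, and D^-1 <= 1 / lambda_min D. *)

Set Implicit Arguments.
Unset Strict Implicit.
Unset Printing Implicit Defensive.

Import Order.TTheory GRing.Theory Num.Theory.
Import numFieldNormedType.Exports.

Local Open Scope classical_set_scope.
Local Open Scope ring_scope.

Lemma quad_diag_mx (R : realType) (n : nat) (r : 'rV[R]_n) (v : 'cV[R]_n) :
  (v^T *m diag_mx r *m v) 0 0 = \sum_i r 0 i * v i 0 ^+ 2.
Proof.
rewrite mul_mx_diag mxE; apply: eq_bigr => i _.
by rewrite !mxE expr2 mulrA [v i 0 * _]mulrC.
Qed.

Lemma pos_semidef_diag_mx (R : realType) (n : nat) (r : 'rV[R]_n) :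
  (forall i, 0 <= r 0 i) -> pos_semidef (diag_mx r).
Proof.
move=> r_ge0 v; rewrite quad_diag_mx.
by apply: sumr_ge0 => i _; rewrite mulr_ge0// sqr_ge0.
Qed.

(** A sum of nonnegative terms vanishes only termwise. This definiteness serves both for the norm of
    an eigenvector and for the Gram matrix. *)
Lemma quad_diag_mx_eq0 (R : realType) (n : nat) (r : 'rV[R]_n) (v : 'cV[R]_n) :
  (forall i, 0 < r 0 i) -> (v^T *m diag_mx r *m v) 0 0 = 0 -> v = 0.
Proof.
move=> r_gt0; rewrite quad_diag_mx => /psumr_eq0P H.
apply/colP => i; rewrite mxE; apply/eqP.
have /eqP := H (fun i _ => mulr_ge0 (ltW (r_gt0 i)) (sqr_ge0 _)) i isT.
by rewrite mulf_eq0 sqrf_eq0 (gt_eqF (r_gt0 i)).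
Qed.

Lemma pos_semidef_congr (R : realType) (m n : nat) (A : 'M[R]_m)
    (P : 'M[R]_(m, n)) :
  pos_semidef A -> pos_semidef (P^T *m A *m P).
Proof. by move=> A_ge0 v; have := A_ge0 (P *m v); rewrite trmx_mul !mulmxA. Qed.

Lemma symmetricmxE (R : realType) (n : nat) (A : 'M[R]_n) :
  (A \is symmetricmx) = (A == A^T).
Proof. by rewrite is_hermitianmxE expr0 scale1r map_mx_id. Qed.

Lemma symmetric_pos_semidef (R : realType) (n : nat) (D P : 'M[R]_n) :
  pos_semidef D -> P^T = P -> P *m D *m P = P ->
  P \is symmetricmx /\ pos_semidef P.
Proof.
move=> D_ge0 PT PDP; split; first by rewrite symmetricmxE PT.
by rewrite -PDP -{1}PT; exact: pos_semidef_congr.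
Qed.

Lemma invmx_diag_mx (R : realType) (n : nat) (r : 'rV[R]_n) :
  (forall i, 0 < r 0 i) ->
  diag_mx r \in unitmx /\ invmx (diag_mx r) = diag_mx (\row_i (r 0 i)^-1).
Proof.
move=> r_gt0.
have rV : diag_mx r *m diag_mx (\row_i (r 0 i)^-1) = 1%:M.
  rewrite mul_diag_mx; apply/matrixP => i j; rewrite !mxE.
  by case: eqVneq => [->|_]; rewrite ?mulr0// mulr1n divff// gt_eqF.
have [rU _] := mulmx1_unit rV; split=> //.
by rewrite -[LHS]mulmx1 -rV mulKmx.
Qed.

(** At an index [i] where an eigenvector is nonzero, its equation reads [r 0 i * v 0 i = a * v 0 i];
    conversely, basis vectors are eigenvectors. *)
Lemma eigenvalue_diag_mx (R : realType) (n : nat) (r : 'rV[R]_n) (a : R) :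
  reflect (exists i, a = r 0 i) (eigenvalue (diag_mx r) a).
Proof.
apply: (iffP eigenvalueP) => [[v + /rV0Pn[i vi]]|[i ->]].
  rewrite mul_mx_diag => /rowP/(_ i); rewrite !mxE mulrC => /(mulIf vi).
  by exists i.
exists (delta_mx 0 i).
  rewrite mul_mx_diag; apply/rowP => j; rewrite !mxE eqxx /=.
  by case: eqVneq => [->|_]; rewrite ?mulr0 ?mul0r// mulr1 mul1r.
by apply/rV0Pn; exists i; rewrite mxE !eqxx oner_eq0.
Qed.

(** The spectrum is the finite set of diagonal entries, nonempty as [0 < n], so the infimum is
    attained; attainment later makes it positive. *)
Lemma lambda_min_diag_mx (R : realType) (n : nat) (r : 'rV[R]_n) :
  (0 < n)%N -> exists2 i, lambda_min (diag_mx r) = r 0 i &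
    forall j, lambda_min (diag_mx r) <= r 0 j.
Proof.
case: n r => // n r _.
have [i _ r_min] := arg_minP (fun i => r 0 i) (isT : xpredT (ord0 : 'I_n.+1)).
have lb : lbound [set a | eigenvalue (diag_mx r) a] (r 0 i).
  by move=> _ /eigenvalue_diag_mx[j ->]; exact: r_min.
have eigr j : [set a | eigenvalue (diag_mx r) a] (r 0 j).
  by apply/eigenvalue_diag_mx; exists j.
have min_le j : lambda_min (diag_mx r) <= r 0 j.
  by apply: ge_inf (eigr j); exists (r 0 i).
exists i => //; apply/le_anti; rewrite min_le lb_le_inf//.
by exists (r 0 i).
Qed.

(** Testing the form on an eigenvector [v] gives [0 <= (c - a) * |v|^2] with [|v|^2 > 0].
    Eigenvectors are rows here, hence the test vector [v^T]. *)
Lemma eigenvalue_le (R : realType) (n : nat) (A : 'M[R]_n) (c a : R) :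
  pos_semidef (c%:M - A) -> eigenvalue A a -> a <= c.
Proof.
move=> cA_ge0 /eigenvalueP[v vA v0]; have := cA_ge0 v^T.
rewrite trmxK mulmxBr vA mul_mx_scalar -scalerBl -scalemxAl mxE.
have vv_ge0 : 0 <= (v *m v^T) 0 0.
  by rewrite mxE; apply: sumr_ge0 => i _; rewrite mxE -expr2 sqr_ge0.
have vv_gt0 : 0 < (v *m v^T) 0 0.
  rewrite lt_def vv_ge0 andbT; apply: contra_neq v0 => vv0.
  apply: trmx_inj; rewrite trmx0.
  (* The squared norm is the diagonal form with all weights 1. *)
  apply: (@quad_diag_mx_eq0 _ _ (const_mx 1)) => [i|]; first by rewrite mxE.
  by rewrite diag_const_mx mulmx1 trmxK.
by rewrite pmulr_lge0// subr_ge0.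
Qed.

(* The hypothesis [0 <= c] covers an empty spectrum, where [lambda_max] is the
   junk value [0]. *)
Lemma lambda_max_le (R : realType) (n : nat) (A : 'M[R]_n) (c : R) :
  0 <= c -> pos_semidef (c%:M - A) -> lambda_max A <= c.
Proof.
move=> c_ge0 cA_ge0; rewrite /lambda_max.
have [->|/set0P eig] := eqVneq [set a | eigenvalue A a] set0.
  by rewrite sup0.
by apply: ge_sup eig _ => a; exact: eigenvalue_le.
Qed.

(** If [u] kills the Gram matrix on the left, the form of [diag_mx k] vanishes at [E *m u^T], so
    [u *m E^T = 0], and full rank gives [u = 0]. *)
Lemma gram_unitmx (R : realType) (m l : nat) (k : 'rV[R]_m)
    (E : 'M[R]_(m, l)) :
  (forall i, 0 < k 0 i) -> \rank E^T = l -> E^T *m diag_mx k *m E \in unitmx.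
Proof.
move=> k_gt0 rkE; have freeE : row_free E^T by rewrite /row_free rkE.
rewrite -row_free_unit; apply: inj_row_free => u uG0.
apply: (row_free_inj freeE); rewrite mul0mx.
apply: trmx_inj; rewrite trmx0; apply: (quad_diag_mx_eq0 k_gt0).
by rewrite trmxK trmx_mul trmxK !mulmxA in uG0 *; rewrite uG0 mul0mx mxE.
Qed.

Lemma weighted_projection (R : realType) (m l : nat) (r : 'rV[R]_m)
    (E : 'M[R]_(m, l)) :
  (0 < m)%N -> (forall i, 0 < r 0 i) -> \rank E^T = l ->
  let D := diag_mx r in
  let A1 := invmx D *m E *m invmx (E^T *m invmx D *m E) *m E^T in
  [/\ A1 *m invmx D \is symmetricmx /\ pos_semidef (A1 *m invmx D),
      (- (A1 - 1%:M)) *m invmx D \is symmetricmx /\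
        pos_semidef ((- (A1 - 1%:M)) *m invmx D)
    & lambda_max (A1 *m invmx D) <= 1 / lambda_min D].
Proof.
move=> m_gt0 r_gt0 rkE D A1.
have [Du DV] := invmx_diag_mx r_gt0; rewrite -/D in Du DV.
have D_ge0 : pos_semidef D by apply: pos_semidef_diag_mx => i; exact: ltW.
have KT : (invmx D)^T = invmx D by rewrite DV tr_diag_mx.
have Gu : E^T *m invmx D *m E \in unitmx.
  by rewrite DV; apply: gram_unitmx => // i; rewrite mxE invr_gt0.
set G := E^T *m invmx D *m E in Gu A1 *.
have GT : G^T = G by rewrite !trmx_mul KT trmxK mulmxA.
set B := A1 *m invmx D.
have GVT : (invmx G)^T = invmx G by rewrite trmx_inv GT.
have BT : B^T = B by rewrite 4!trmx_mul GVT trmxK KT !mulmxA.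
have BDB : B *m D *m B = B.
  (* Once [invmx D *m D] cancels, both sides start with [invmx D *m E *m invmx G]; what remains
     contains [G *m invmx G]. *)
  rewrite /B mulmxKV// /A1 -!mulmxA; do 3!congr (_ *m _).
  by rewrite !mulmxA -/G mulmxV// mul1mx.
have -> : - (A1 - 1%:M) *m invmx D = invmx D - B.
  by rewrite opprB mulmxBl mul1mx.
have CT : (invmx D - B)^T = invmx D - B by rewrite linearB /= KT BT.
have CDC : (invmx D - B) *m D *m (invmx D - B) = invmx D - B.
  (* The product expands to [(invmx D - B) - (B - B *m D *m B)], whose second term is zero. *)
  by rewrite mulmxBl mulVmx// mulmxBr !mulmxBl !mul1mx BDB mulmxK// subrr subr0.
have [C_sym C_ge0] := symmetric_pos_semidef D_ge0 CT CDC.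
split=> //; first exact: symmetric_pos_semidef BDB.
have [i lminE lmin_le] := lambda_min_diag_mx r m_gt0.
have lmin_gt0 : 0 < lambda_min D by rewrite lminE.
rewrite div1r; apply: lambda_max_le; first by rewrite invr_ge0 ltW.
(* With [c = (lambda_min D)^-1], split [c%:M - B] as [(c%:M - invmx D) + (invmx D - B)]; the first
   summand is diagonal with entries [c - (r 0 j)^-1]. *)
move=> v; rewrite -[X in X - B](subrK (invmx D)) -addrA mulmxDr mulmxDl mxE.
apply: addr_ge0 (C_ge0 v).
rewrite DV -diag_const_mx -linearB; apply: pos_semidef_diag_mx => j.
by rewrite !mxE subr_ge0 lef_pV2 ?posrE.
Qed.

Theorem lemma2p3 (R : realType) (d m l : nat)
    (Dom : set 'rV[R]_d)
    (Dom_open : open Dom) (Dom_connected : connected Dom)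
    (Dom_bounded : bounded_set Dom)
    (xs : 'I_m -> 'rV[R]_d)
    (xs_Dom : forall i, Dom (xs i)) (xs_inj : injective xs)
    (p : 'I_l -> 'rV[R]_d -> R)
    (p_cont : forall j, {within Dom, continuous (p j)})
    (p_indep : lin_indep_on Dom p)
    (p_one : in_span_on Dom p (fun=> 1))
    (lm : (1 <= l <= m)%N)
    (W : R -> \bar R) (W_weight : weight_function W)
    (w_smooth : smooth_on_nneg (inverse_weight W))
    (x : 'rV[R]_d) (x_Dom : Dom x)
    (w_pos : forall i, 0 < inverse_weight W (enorm (x - xs i))) :
  let E : 'M[R]_(m, l) := \matrix_(i < m, j < l) p j (xs i) in
  let D : 'M[R]_m :=
    2 *: diag_mx (\row_(i < m) inverse_weight W (enorm (x - xs i))) in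
  let A1 : 'M[R]_m :=
    invmx D *m E *m invmx (E^T *m invmx D *m E) *m E^T in
  let A2 : 'M[R]_m := A1 - 1%:M in
  \rank E^T = l ->
  [/\ A1 *m invmx D \is symmetricmx /\ pos_semidef (A1 *m invmx D),
      (- A2) *m invmx D \is symmetricmx /\ pos_semidef ((- A2) *m invmx D)
    & lambda_max (A1 *m invmx D) <= 1 / lambda_min D].
Proof.
move=> E D A1 A2 rkE.
have m_gt0 : (0 < m)%N by case/andP: lm; exact: leq_trans.
(* The factor 2 is absorbed into the diagonal. *)
pose r := \row_(i < m) (2 * inverse_weight W (enorm (x - xs i))).
have r_gt0 i : 0 < r 0 i by rewrite mxE mulr_gt0.
have DE : D = diag_mx r.
  by rewrite /D -linearZ; congr diag_mx; apply/rowP => i; rewrite !mxE.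
by have := weighted_projection m_gt0 r_gt0 rkE; rewrite -DE.
Qed.
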